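(* ($2\times2$ discrete Chebyshev / $q$-ultraspherical type polynomials at a root of unity.) In the setting of the context, $$P^2\cdot\Phi_j=\alpha_j\Phi_j,\quad H^2\cdot e_k=\Lambda_ke_k,\quad P^2\cdot e_k=A_{k+1}^*e_{k+1}+B_ke_k+A_ke_{k-1},\quad H^2\cdot\Phi_j=A_{j+1}^*\Phi_{j+1}+B_j\Phi_j+A_j\Phi_{j-1},$$ with $A_k$ invertible for $k=1,\dots,m$ and $B_k=B_k^*$, and the matrices $L(j)$ and $(e_0,\Phi_j)=L(j)\operatorname{diag}(w_{2j}^{1/2},w_{2j+1}^{1/2})$ are invertible for $j=0,\dots,m$. Put $\theta_j=(e_0,\Phi_j)\alpha_j^*(e_0,\Phi_j)^{-1}$. Then there is a family of matrix valued polynomials $\Pi_k(x)=\sum_{i=0}^kM_{k,i}x^i$, $k=0,\dots,m$ ($M_{k,i}\in M_2(\mathbb C)$, $M_{k,k}$ invertible, $x\in M_2(\mathbb C)$), such that for all $j,k,\ell\in\{0,\dots,m\}$: (i) $\Pi_k(\theta_j)\theta_j=A_{k+1}^*\Pi_{k+1}(\theta_j)+B_k\Pi_k(\theta_j)+A_k\Pi_{k-1}(\theta_j)$, with $\Pi_{-1}(\theta_j)=0$, $\Pi_0(\theta_j)=I_2$ (the term with $\Pi_{m+1}$ omitted for $k=m$); (ii) $\sum_{j=0}^m\Pi_k(\theta_j)W(j)\Pi_\ell(\theta_j)^*=\delta_{k,\ell}I_2$, where $W(j)=L(j)D(j)L(j)^*$, $D(j)=\operatorname{diag}(w_{2j},w_{2j+1})$;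 (iii) the difference equation $$\Lambda_k\Pi_k(\theta_j)=\Pi_k(\theta_{j+1})(e_0,\Phi_{j+1})A_{j+1}(e_0,\Phi_j)+\Pi_k(\theta_j)(e_0,\Phi_j)B_j(e_0,\Phi_j)+\Pi_k(\theta_{j-1})(e_0,\Phi_{j-1})A_j^*(e_0,\Phi_j),$$ where terms with index $j+1=m+1$ or $j-1=-1$ are omitted; (iv) $\Pi_k(\theta_j)=R_k(j)L(j)^{-1}$, where $$R_k(j)=\begin{pmatrix} h_{2k}^{-1/2}P_{2k}(x_{2j}) & h_{2k}^{-1/2}P_{2k}(x_{2j+1}) \\ {h_{2k+1}^{-1/2}}P_{2k+1}(x_{2j}) & h_{2k+1}^{-1/2}P_{2k+1}(x_{2j+1}) \end{pmatrix}.$$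
   Context: $A^*$ is the conjugate transpose. Let $N$ be a positive integer, $\omega=\pi/N$, $m\ge0$, $d+1=2(m+1)$ with $1\le d\le N-1$, $2\beta=N-d$ with $\beta\in\mathbb N$, and $b\in\mathbb R$. Let $V$ be a complex inner product space with orthonormal basis $|k\rangle$, $k=0,\dots,d$; $\langle\cdot,\cdot\rangle$ is linear in the first argument. The $(d+1)$-dimensional unitary irreducible representation of $\mathfrak{so}_q(3)$, $q=e^{2i\omega}$ (generators $K_0,K_1,K_2$ with $[K_0,K_1]_\omega=K_2$, $[K_1,K_2]_\omega=-K_0$, $[K_0,K_2]_\omega=K_1$, where $[A,B]_\omega=e^{i\omega/2}AB-e^{-i\omega/2}BA$) has $K_0,K_1$ acting on $V$ by $$K_0|k\rangle=\lambda_k|k\rangle,\quad K_1|k\rangle=\rho_{k+1}|k+1\rangle+\rho_k|k-1\rangle,$$ $$\lambda_k=\frac{\cos\omega(k+\beta)}{\sin\omega},\qquad \rho_k=\sqrt{\frac{\sin\omega k\,\sin\omega(k+2\beta-1)}{4\sin^2\omega\,\sin\omega(k+\beta)\sin\omega(k+\beta-1)}}\quad(1\le k\le d),\qquad \rho_0=\rho_{d+1}=0.$$ It is known that $K_1$ has the same spectrum as $K_0$. Put $P=K_1+b$ and $H=K_0$. Let $|\phi_j\rangle$, $j=0,\dots,d$, be the orthonormal eigenbasis $P|\phi_j\rangle=\mu_j|\phi_j\rangle$, $\mu_j=\frac{\cos\omega(j+\beta)}{\sin\omega}+b$, on which $H|\phi_j\rangle=\rho_{j+1}|\phi_{j+1}\rangle+\rho_j|\phi_{j-1}\rangle$.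 Let $x_j=2\cos\omega(j+\beta)$. The monic $q$-ultraspherical polynomials $P_k$ ($0\le k\le d$) at $q$ a root of unity are given by $P_{-1}=0$, $P_0=1$, $xP_k(x)=P_{k+1}(x)+4\sin^2(\omega)\rho_k^2P_{k-1}(x)$, and are recovered as overlaps $P_k(x_j)=\langle k|\phi_j\rangle h_k^{1/2}w_j^{-1/2}$, with $w_j=\sin\omega(j+\beta)\prod_{\ell=1}^{2\beta-1}\sin\omega(j+\ell)$ and $h_k=\sum_{j=0}^dP_k(x_j)^2w_j$. (For $\beta=1$ these are the finite Chebyshev polynomials $P_k(x_j)=\sin(\omega(k+1)(j+1))/\sin(\omega(j+1))$, with $w_j=\sin^2\omega(j+1)$.) $V^2$ is the left $M_2(\mathbb C)$-module with action $A(v_1,v_2)=(a_{11}v_1+a_{12}v_2,a_{21}v_1+a_{22}v_2)$ and matrix valued inner product $(v,w)=(\langle v_i,w_j\rangle)_{i,j}\in M_2(\mathbb C)$; operators on $V$ act componentwise. For $k,j=0,\dots,m$: $e_k=(|2k\rangle,|2k+1\rangle)$, $\Phi_j=(|\phi_{2j}\rangle,|\phi_{2j+1}\rangle)$ (with $e_{-1}=e_{m+1}=\Phi_{-1}=\Phi_{m+1}=0$), $\alpha_j=\operatorname{diag}(\mu_{2j}^2,\mu_{2j+1}^2)$, $\Lambda_k=\operatorname{diag}(\lambda_{2k}^2,\lambda_{2k+1}^2)$, and $$A_k=\begin{pmatrix} \rho_{2k}\rho_{2k-1} & 2b\rho_{2k} \\ 0 & \rho_{2k}\rho_{2k+1}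 \end{pmatrix}\ (1\le k\le m),\qquad B_k=\begin{pmatrix} \rho_{2k}^2+\rho_{2k+1}^2+b^2 & 2b\rho_{2k+1} \\ 2b\rho_{2k+1} & \rho_{2k+1}^2+\rho_{2k+2}^2+b^2 \end{pmatrix}\ (0\le k\le m).$$ Finally $$L(j)=\begin{pmatrix} h_0^{-1/2} & 0 \\ 0 & h_1^{-1/2} \end{pmatrix}\begin{pmatrix} 1 & 1 \\ {P_1(x_{2j})} & P_1(x_{2j+1}) \end{pmatrix}.$$
   Formalization: In the formula for H²·Φ_j and in (iii), the matrices A_j, B_j are taken at b=0 (as printed it fails for b≠0, since H=K_0), and the last factor (e_0,Φ_j) in each term of (iii) is replaced by its inverse (as printed it fails, e.g. N=5, d=3, b=0). *)

(* Defs.v *)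
From HB Require Import structures.
From mathcomp Require Import all_boot all_order all_algebra.
From mathcomp Require Import all_classical all_reals all_analysis.
From mathcomp Require Export complex.

Set Implicit Arguments.
Unset Strict Implicit.
Unset Printing Implicit Defensive.

Import Order.TTheory GRing.Theory Num.Theory.

Local Open Scope ring_scope.
Local Open Scope complex_scope.

(* In this file N, d, m, beta are as follows: omega = pi / N, the representation
   space has dimension d + 1 = 2 (m + 1), and 2 beta = N - d. *)

Definition omega {R : realType} (N : nat) : R := pi / N%:R.

Definition lam {R : realType} (N beta k : nat) : R :=
  cos (omega N * (k + beta)%:R) / sin (omega N).

Definition mu {R : realType} (N beta : nat) (b : R) (j : nat) : R :=
  lam N beta j + b.

(* rho_0 = rho_(d+1) = 0 by convention; for beta = 1 the general formula would
   divide by zero at k = 0. *)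
Definition rho {R : realType} (N d beta k : nat) : R :=
  if (1 <= k <= d)%N then
    Num.sqrt (sin (omega N * k%:R) * sin (omega N * (k + beta.*2 - 1)%:R) /
      (4 * sin (omega N) ^+ 2 * sin (omega N * (k + beta)%:R)
         * sin (omega N * (k + beta - 1)%:R)))
  else 0.

(* The monic q-ultraspherical polynomials at a root of unity. *)
Fixpoint Pq {R : realType} (N d beta k : nat) : {poly R} :=
  match k with
  | 0 => 1
  | k1.+1 =>
      match k1 with
      | 0 => 'X
      | k2.+1 => 'X * Pq N d beta k1
          - (4 * sin (omega N) ^+ 2 * rho N d beta k1 ^+ 2) *: Pq N d beta k2
      end
  end.

Definition xpt {R : realType} (N beta j : nat) : R :=
  2 * cos (omega N * (j + beta)%:R).

Definition wt {R : realType} (N beta j : nat) : R :=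
  sin (omega N * (j + beta)%:R)
    * \prod_(1 <= l < beta.*2) sin (omega N * (j + l)%:R).

Definition hnorm {R : realType} (N d beta k : nat) : R :=
  \sum_(j < d.+1) (Pq N d beta k).[xpt N beta j] ^+ 2 * wt N beta j.

(* The complex matrix ((a, b), (c, d)) with real entries. *)
Definition mx22 {R : realType} (a b c d : R) : 'M[R[i]]_2 :=
  \matrix_(i < 2, j < 2)
    (if i == 0 then if j == 0 then a else b
     else if j == 0 then c else d)%:C.

Definition adjmx {R : realType} (A : 'M[R[i]]_2) : 'M[R[i]]_2 :=
  map_mx Num.conj A^T.

Definition alphamx {R : realType} (N beta : nat) (b : R) (j : nat) :=
  mx22 (mu N beta b j.*2 ^+ 2) 0 0 (mu N beta b j.*2.+1 ^+ 2).

Definition Lambdamx {R : realType} (N beta k : nat) : 'M[R[i]]_2 :=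
  mx22 (lam N beta k.*2 ^+ 2) 0 0 (lam N beta k.*2.+1 ^+ 2).

(* Coefficients of (K_1 + b)^2 on the pairs (|2k>, |2k+1>). Since K_0 acts on
   its dual basis as K_1 does on |k>, those of H^2 = K_0^2 are the ones at
   b = 0. *)
Definition Amx {R : realType} (N d beta : nat) (b : R) (k : nat) :=
  let r := rho N d beta in
  mx22 (r k.*2 * r k.*2.-1) (2 * b * r k.*2)
       0                    (r k.*2 * r k.*2.+1).

Definition Bmx {R : realType} (N d beta : nat) (b : R) (k : nat) :=
  let r := rho N d beta in
  mx22 (r k.*2 ^+ 2 + r k.*2.+1 ^+ 2 + b ^+ 2) (2 * b * r k.*2.+1)
       (2 * b * r k.*2.+1) (r k.*2.+1 ^+ 2 + r k.*2.+2 ^+ 2 + b ^+ 2).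

Definition Lmx {R : realType} (N d beta j : nat) : 'M[R[i]]_2 :=
  let h := hnorm N d beta in
  let p k i := (Pq N d beta k).[xpt N beta i] in
  mx22 (Num.sqrt (h 0))^-1 0 0 (Num.sqrt (h 1))^-1
    *m mx22 1           1
            (p 1 j.*2)  (p 1 j.*2.+1).

Definition Dmx {R : realType} (N beta j : nat) : 'M[R[i]]_2 :=
  mx22 (wt N beta j.*2) 0 0 (wt N beta j.*2.+1).

Definition sqrtDmx {R : realType} (N beta j : nat) : 'M[R[i]]_2 :=
  mx22 (Num.sqrt (wt N beta j.*2)) 0 0 (Num.sqrt (wt N beta j.*2.+1)).

Definition Wmx {R : realType} (N d beta j : nat) : 'M[R[i]]_2 :=
  Lmx N d beta j *m Dmx N beta j *m adjmx (Lmx N d beta j).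

Definition Rmx {R : realType} (N d beta k j : nat) : 'M[R[i]]_2 :=
  let p k i := (Num.sqrt (hnorm N d beta k))^-1
                 * (Pq N d beta k).[xpt N beta i] in
  mx22 (p k.*2 j.*2)    (p k.*2 j.*2.+1)
       (p k.*2.+1 j.*2) (p k.*2.+1 j.*2.+1).

(* V ^ 2 (finite functions 'I_2 -> V) as a left module over 'M_2, with
   componentwise action of operators and matrix valued inner product. *)
Definition mxact {R : realType} {V : vectType R[i]}
    (A : 'M[R[i]]_2) (v : V ^ 2) : V ^ 2 :=
  [ffun i => \sum_(j < 2) A i j *: v j].

Definition opact {R : realType} {V : vectType R[i]}
    (T : 'End(V)) (v : V ^ 2) : V ^ 2 :=
  [ffun i => T (v i)].

Definition mxdot {R : realType} {V : vectType R[i]}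
    (dot : {dot V for Num.conj}) (v w : V ^ 2) : 'M[R[i]]_2 :=
  \matrix_(i < 2, j < 2) dot (v i) (w j).

Definition orthonormal_basis {R : realType} {V : vectType R[i]}
    (dot : {dot V for Num.conj}) (s : seq V) : Prop :=
  basis_of fullv s /\ orthonormal dot s.

(* e_k and Phi_j are the blocks of the two bases of V. *)
Definition block {R : realType} {V : vectType R[i]} (s : seq V) (k : nat) : V ^ 2 :=
  [ffun i : 'I_2 => if i == 0 then s`_(k.*2) else s`_(k.*2.+1)].

Definition thetamx {R : realType} {V : vectType R[i]}
    (dot : {dot V for Num.conj}) (ket phi : seq V)
    (N beta : nat) (b : R) (j : nat) : 'M[R[i]]_2 :=
  let E := mxdot dot (block ket 0) (block phi j) in
  E *m adjmx (alphamx N beta b j) *m invmx E.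

(* Main.v *)
Require Import Defs.
From HB Require Import structures.
From mathcomp Require Import all_boot all_order all_algebra.
From mathcomp Require Import all_classical all_reals all_analysis.
From mathcomp Require Import ring zify.

(* [P] is real diagonal in the orthonormal basis [phi] and [H] in the basis
   [ket], so both are self-adjoint. Moving [P] across [<k|phi_j>] gives the
   three-term recurrence in [k], hence [<k|phi_j>] is [P_k(x_j) <0|phi_j>] up
   to a factor independent of [j]; moving [H] across [<0|phi_j>] gives a
   recurrence in [j], which [sqrt w_j] solves because
   [sin (a + c) + sin (a - c) = 2 sin a cos c]. Parseval fixes the
   normalisations, so [<k|phi_j> = h_k^(-1/2) P_k(x_j) w_j^(1/2)].
   Squaring the two tridiagonal actions makes them block tridiagonal on pairs.
   If [Pi_k] is the solution of the recurrence of [P^2], then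
   [Pi_k(theta_j) (e_0, Phi_j) = (e_k, Phi_j)]; self-adjointness of [H^2] and
   Parseval for the blocks give the difference equation and the
   orthogonality. *)

Set Implicit Arguments.
Unset Strict Implicit.

Import Order.TTheory GRing.Theory Num.Theory.

Local Open Scope ring_scope.
Local Open Scope complex_scope.

(** * Trigonometric identities for the coefficients and weights at a root of unity *)

Section Trigonometry.
Context {R : realType} {N d beta : nat}.
Hypothesis beta_gt0 : (0 < beta)%N.
Hypothesis Nd : (N = d + beta.*2)%N.

Local Notation om := (omega N : R).
Local Notation S n := (sin (omega N * n%:R) : R).

Lemma omega_natr_pi : om * N%:R = pi.
Proof.
by rewrite /omega mulfVK// pnatr_eq0; lia.
Qed.

Lemma omega_gt0 : 0 < om.
Proof. by rewrite /omega divr_gt0 ?pi_gt0// ltr0n; lia. Qed.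

Lemma omega_natr_itv n : (n <= N)%N -> om * n%:R \in `[0, pi].
Proof.
move=> nN; rewrite in_itv/= mulr_ge0 ?(ltW omega_gt0)//=.
by rewrite -omega_natr_pi ler_pM2l ?omega_gt0// ler_nat.
Qed.

Lemma sin_omega_gt0 n : (0 < n < N)%N -> 0 < S n.
Proof.
move=> /andP[n0 nN]; apply: sin_gt0_pi.
rewrite mulr_gt0 ?omega_gt0 ?ltr0n//=.
by rewrite -omega_natr_pi ltr_pM2l ?omega_gt0// ltr_nat.
Qed.

Lemma sin_omega1_gt0 : (0 < d)%N -> 0 < sin om.
Proof. by move=> d0; have := @sin_omega_gt0 1; rewrite mulr1; apply; lia. Qed.

Lemma wt_gt0 j : (j <= d)%N -> 0 < wt N beta j :> R.
Proof.
move=> jd; rewrite mulr_gt0 ?sin_omega_gt0//; first by lia.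
rewrite big_nat_cond; apply: prodr_gt0 => l /andP[/andP[l0 lb] _].
by apply: sin_omega_gt0; lia.
Qed.

Lemma rho_out k : ~~ (1 <= k <= d)%N -> rho N d beta k = 0 :> R.
Proof. by rewrite /rho => /negbTE ->. Qed.

Lemma rho_den_gt0 k : (1 <= k <= d)%N ->
  0 < 4 * sin om ^+ 2 * S (k + beta) * S (k + beta - 1).
Proof.
move=> kd; rewrite !mulr_gt0 ?exprn_gt0 ?sin_omega1_gt0 ?sin_omega_gt0//; lia.
Qed.

Lemma rho_gt0 k : (1 <= k <= d)%N -> 0 < rho N d beta k :> R.
Proof.
move=> kd; rewrite /rho kd sqrtr_gt0 divr_gt0 ?rho_den_gt0// mulr_gt0//.
  by apply: sin_omega_gt0; lia.
by apply: sin_omega_gt0; lia.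
Qed.

Lemma rho_sqr k : (1 <= k <= d)%N ->
  rho N d beta k ^+ 2 * (4 * sin om ^+ 2 * S (k + beta) * S (k + beta - 1))
  = S k * S (k + beta.*2 - 1) :> R.
Proof.
move=> kd; rewrite /rho kd sqr_sqrtr ?mulfVK ?gt_eqF ?rho_den_gt0//.
rewrite ltW// divr_gt0 ?rho_den_gt0// mulr_gt0//.
  by apply: sin_omega_gt0; lia.
by apply: sin_omega_gt0; lia.
Qed.

(** Passing from [j] to [j.+1] slides the window of sines $j+1,\dots,j+2\beta-1$ by one place, so
    only its two end factors change. The cross-multiplied form avoids divisions. *)
Lemma wt_recr j : wt N beta j.+1 * S j.+1 * S (j + beta)
  = wt N beta j * S (j.+1 + beta) * S (j + beta.*2) :> R.
Proof.
rewrite /wt.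
have shift : (\prod_(1 <= l < beta.*2) S (j.+1 + l)) * S j.+1
           = (\prod_(1 <= l < beta.*2) S (j + l)) * S (j + beta.*2).
  have b1 : (1 <= beta.*2)%N by lia.
  rewrite -[RHS](big_nat_recr _ _ (fun l => S (j + l)))//= big_nat_recl//.
  rewrite mulrC addn1; congr (_ * _).
  by apply: eq_bigr => l _; rewrite addnS.
transitivity (S (j.+1 + beta) * S (j + beta)
    * ((\prod_(1 <= l < beta.*2) S (j.+1 + l)) * S j.+1)); first by ring.
by rewrite shift; ring.
Qed.

Lemma sqrt_eqM (x y a c : R) : 0 <= x -> 0 <= y -> 0 <= a -> 0 <= c ->
  a ^+ 2 * x = c ^+ 2 * y -> a * Num.sqrt x = c * Num.sqrt y.
Proof.
move=> x0 y0 a0 c0 e; apply/eqP; rewrite -(@eqrXn2 _ 2)//; last first.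
- by rewrite mulr_ge0 ?sqrtr_ge0.
- by rewrite mulr_ge0 ?sqrtr_ge0.
by rewrite !exprMn !sqr_sqrtr// e.
Qed.

(** By [rho_sqr] and [wt_recr] the quotient $\rho_{j+1}^2w_{j+1}/w_j$ is the square of a rational
    expression in sines, and likewise with the two weights exchanged. The square roots therefore
    disappear from the coefficients. *)
Lemma rho_sqrt_wt j : (j < d)%N ->
  rho N d beta j.+1 * Num.sqrt (wt N beta j.+1)
    = S (j + beta.*2) / (2 * sin om * S (j + beta)) * Num.sqrt (wt N beta j)
  /\ rho N d beta j.+1 * Num.sqrt (wt N beta j)
    = S j.+1 / (2 * sin om * S (j.+1 + beta)) * Num.sqrt (wt N beta j.+1).
Proof.
move=> jd.
have s0 : 0 < sin om by apply: sin_omega1_gt0; lia.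
have s1 : 0 < S (j + beta) by apply: sin_omega_gt0; lia.
have s2 : 0 < S (j.+1 + beta) by apply: sin_omega_gt0; lia.
have s3 : 0 < S (j + beta.*2) by apply: sin_omega_gt0; lia.
have s4 : 0 < S j.+1 by apply: sin_omega_gt0; lia.
have w0 : 0 < wt N beta j :> R by apply: wt_gt0; lia.
have w1 : 0 < wt N beta j.+1 :> R by apply: wt_gt0; lia.
have r1 : 0 < rho N d beta j.+1 :> R by apply: rho_gt0; lia.
have den : 0 < 4 * sin om ^+ 2 * S (j.+1 + beta) * S (j + beta).
  by rewrite !mulr_gt0// exprn_gt0.
have ew := canRL (mulfK (lt0r_neq0 s4)) (canRL (mulfK (lt0r_neq0 s1)) (wt_recr j)).
have er : rho N d beta j.+1 ^+ 2 = S j.+1 * S (j + beta.*2)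
    / (4 * sin om ^+ 2 * S (j.+1 + beta) * S (j + beta)).
  apply: (canRL (mulfK (lt0r_neq0 den))).
  by have := @rho_sqr j.+1 jd; rewrite !addSn !subn1.
by split; (apply: sqrt_eqM;
  [exact: ltW | exact: ltW | exact: ltW | by rewrite ltW// divr_gt0 ?mulr_gt0 |
   rewrite er ew; field; rewrite !lt0r_neq0]).
Qed.

(** This is the recurrence in [j] that $\langle 0|\phi_j\rangle$ satisfies, with eigenvalue
    $\lambda_0$. It is stated for [j < d], which is what an induction from [j] to [j.+1] up to [d]
    uses. *)
Lemma sqrt_wt_recr j : (j < d)%N ->
  rho N d beta j.+1 * Num.sqrt (wt N beta j.+1)
  + rho N d beta j * Num.sqrt (wt N beta j.-1)
  = lam N beta 0 * Num.sqrt (wt N beta j) :> R.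
Proof.
move=> jd.
have s0 : 0 < sin om by apply: sin_omega1_gt0; lia.
have s1 : 0 < S (j + beta) by apply: sin_omega_gt0; lia.
(* For [j = 0] both sides vanish, by $\rho_0=0$ and $\sin 0=0$; otherwise this is the second
   identity of [rho_sqrt_wt], one index lower. *)
have -> : rho N d beta j * Num.sqrt (wt N beta j.-1)
        = S j / (2 * sin om * S (j + beta)) * Num.sqrt (wt N beta j).
  case: j jd s1 => [|j] jd s1.
    by rewrite rho_out// mulr0 sin0 !mul0r.
  by rewrite (@rho_sqrt_wt j (ltnW jd)).2.
rewrite (@rho_sqrt_wt j jd).1 -mulrDl -mulrDl; congr (_ * _).
(* Sum of sines at $a\pm c$, with $a=\omega(j+\beta)$ and $c=\omega\beta$. *)
have sumS : S (j + beta.*2) + S j = 2 * S (j + beta) * cos (om * (0 + beta)%:R).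
  have -> : om * (j + beta.*2)%:R = om * (j + beta)%:R + om * (0 + beta)%:R.
    by rewrite -mulrDr -natrD; congr (_ * _%:R); lia.
  have -> : om * j%:R = om * (j + beta)%:R - om * (0 + beta)%:R.
    by rewrite -mulrBr add0n natrD addrK.
  by rewrite sinD sinB; ring.
rewrite sumS /lam; field.
by rewrite !lt0r_neq0.
Qed.

(** The angles $\omega(j+\beta)$ lie in $[0,\pi]$, where the cosine is injective. Distinctness of
    the nodes makes $L(j)$ invertible. *)
Lemma xpt_inj i j : (i <= d)%N -> (j <= d)%N ->
  xpt N beta i = xpt N beta j :> R -> i = j.
Proof.
move=> id jd /(mulfI _); rewrite pnatr_eq0 => /(_ isT) /cos_inj.
move=> /(_ _ _)/wrap[]; try by apply: omega_natr_itv; lia.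
move=> /(mulfI (lt0r_neq0 omega_gt0))/eqP; rewrite eqr_nat; lia.
Qed.

Lemma xpt_lam j : (0 < d)%N -> xpt N beta j = 2 * sin om * lam N beta j :> R.
Proof.
move=> d0; rewrite /xpt /lam; field.
by rewrite lt0r_neq0// sin_omega1_gt0.
Qed.

End Trigonometry.

(** * Scalar inner products and orthonormal bases *)

Section InnerProduct.
Context {R : realType} {V : vectType R[i]} (dot : {dot V for Num.conj}).

Lemma conj_real_complex (x : R) : Num.conj (x%:C) = x%:C.
Proof. by rewrite conj_Creal//; apply/complex_realP; exists x. Qed.

Lemma real_complexM (x y : R) : x%:C * y%:C = (x * y)%:C.
Proof. by rewrite rmorphM. Qed.

Lemma real_complexD (x y : R) : x%:C + y%:C = (x + y)%:C.
Proof. by rewrite rmorphD. Qed.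

Lemma real_complexB (x y : R) : x%:C - y%:C = (x - y)%:C.
Proof. by rewrite rmorphB. Qed.

Lemma dotC u v : dot u v = Num.conj (dot v u).
Proof. by rewrite hermC expr0 mul1r. Qed.

Lemma dotZl a u v : dot (a *: u) v = a * dot u v.
Proof. by rewrite linearZl_LR. Qed.

Lemma dotZr a u v : dot u (a *: v) = Num.conj a * dot u v.
Proof. by rewrite linearZr_LR. Qed.

Lemma dotDl u u' v : dot (u + u') v = dot u v + dot u' v.
Proof. exact: linearDl. Qed.

Lemma dotDr u v v' : dot u (v + v') = dot u v + dot u v'.
Proof. exact: linearDr. Qed.

Lemma dot_suml (I : finType) (F : I -> V) v : dot (\sum_i F i) v = \sum_i dot (F i) v.
Proof. exact: linear_sumlz. Qed.

Lemma onb_dotE {n} (s : n.-tuple V) i j : orthonormal_basis dot s ->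
  (i < n)%N -> (j < n)%N -> dot s`_i s`_j = (i == j)%:R.
Proof.
move=> [_ /orthonormalP[us os]] i_n j_n.
by rewrite os ?mem_nth ?size_tuple// nth_uniq ?size_tuple.
Qed.

Lemma onb_sum {n} (s : n.-tuple V) u : orthonormal_basis dot s ->
  u = \sum_(j < n) dot u s`_j *: s`_j.
Proof.
move=> os; have [bs _] := os.
have us : u \in (span s) by rewrite (span_basis bs) memvf.
rewrite [LHS](coord_span us); apply: eq_bigr => j _; congr (_ *: _).
rewrite [in RHS](coord_span us) dot_suml (bigD1 j)//= big1 ?addr0.
  by rewrite dotZl onb_dotE// eqxx mulr1.
by move=> i; rewrite -val_eqE => /negbTE ij; rewrite dotZl onb_dotE// ij mulr0.
Qed.

Lemma parseval {n} (s : n.-tuple V) u v : orthonormal_basis dot s ->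
  dot u v = \sum_(j < n) dot u s`_j * Num.conj (dot v s`_j).
Proof.
move=> os; rewrite {1}(onb_sum u os) dot_suml; apply: eq_bigr => j _.
by rewrite dotZl [dot s`_j v]dotC.
Qed.

(** In coordinates along [s], [T] multiplies by the [a j], and these are fixed by conjugation;
    Parseval then compares both sides term by term. *)
Lemma real_diag_selfadjoint {n} (s : n.-tuple V) (T : 'End(V)) (a : nat -> R) :
  orthonormal_basis dot s ->
  (forall k, (k < n)%N -> T s`_k = (a k)%:C *: s`_k) ->
  forall u v, dot (T u) v = dot u (T v).
Proof.
move=> os Ts.
have Tdot u (j : 'I_n) : dot (T u) s`_j = (a j)%:C * dot u s`_j.
  rewrite {1}(onb_sum u os) linear_sum dot_suml (bigD1 j)//= big1 ?addr0.
    by rewrite linearZ/= Ts// !dotZl onb_dotE// eqxx mulr1 mulrC.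
  move=> i; rewrite -val_eqE => /negbTE ij.
  by rewrite linearZ/= Ts// !dotZl onb_dotE// ij !mulr0.
move=> u v; rewrite (parseval _ _ os) [RHS](parseval _ _ os).
by apply: eq_bigr => j _; rewrite !Tdot rmorphM /= conj_real_complex; ring.
Qed.

(** * Adjoints, products and invertibility of $2\times2$ matrices *)

Lemma adjmxE (A : 'M[R[i]]_2) i j : adjmx A i j = Num.conj (A j i).
Proof. by rewrite !mxE. Qed.

Lemma adjmxM (A B : 'M[R[i]]_2) : adjmx (A *m B) = adjmx B *m adjmx A.
Proof. by rewrite /adjmx trmx_mul map_mxM. Qed.

Lemma adjmxK (A : 'M[R[i]]_2) : adjmx (adjmx A) = A.
Proof. by apply/matrixP => i j; rewrite !adjmxE conjCK. Qed.

Lemma adjmx_unit (A : 'M[R[i]]_2) : (adjmx A \in unitmx) = (A \in unitmx).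
Proof. by rewrite /adjmx map_unitmx unitmx_tr. Qed.

Lemma adjmx_mx22 (a b c d : R) : adjmx (mx22 a b c d) = mx22 a c b d.
Proof.
apply/matrixP => i j; rewrite adjmxE !mxE conj_real_complex.
by case: (i == 0); case: (j == 0).
Qed.

Lemma mulmx22 (a b c d a' b' c' d' : R) :
  mx22 a b c d *m mx22 a' b' c' d'
  = mx22 (a * a' + b * c') (a * b' + b * d') (c * a' + d * c') (c * b' + d * d').
Proof.
apply/matrixP => i j; rewrite !mxE !big_ord_recl big_ord0 !mxE/= addr0.
by case: (i == 0); case: (j == 0); rewrite !real_complexM real_complexD.
Qed.

Lemma unitmx22 (a b c d : R) : a * d - b * c != 0 -> mx22 a b c d \in unitmx.
Proof.
move=> det0; rewrite unitmxE (expand_det_row _ ord0) !big_ord_recl big_ord0.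
rewrite /cofactor !det_mx11 !mxE/= addr0 expr0 mul1r expr1 mulN1r mulrN.
by rewrite !real_complexM real_complexB unitfE fmorph_eq0.
Qed.

Lemma ffun2P (T : Type) (f g : T ^ 2) : f ord0 = g ord0 ->
  f (lift ord0 ord0) = g (lift ord0 ord0) -> f = g.
Proof.
move=> e0 e1; apply/ffunP => i.
case: (unliftP ord0 i) => [j ->|->//]; by rewrite [j]ord1.
Qed.

(** * The matrix valued inner product on pairs of vectors *)

Lemma mxdotZl A v w : mxdot dot (mxact A v) w = A *m mxdot dot v w.
Proof.
apply/matrixP => i j; rewrite !mxE ffunE dot_suml.
by apply: eq_bigr => k _; rewrite dotZl mxE.
Qed.

Lemma mxdotC v w : mxdot dot v w = adjmx (mxdot dot w v).
Proof. by apply/matrixP => i j; rewrite adjmxE !mxE dotC. Qed.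

Lemma mxdotZr A v w : mxdot dot v (mxact A w) = mxdot dot v w *m adjmx A.
Proof. by rewrite mxdotC mxdotZl adjmxM -mxdotC. Qed.

Lemma mxdotDl v v' w : mxdot dot (v + v') w = mxdot dot v w + mxdot dot v' w.
Proof. by apply/matrixP => i j; rewrite !mxE ffunE dotDl. Qed.

Lemma mxdotDr v w w' : mxdot dot v (w + w') = mxdot dot v w + mxdot dot v w'.
Proof. by apply/matrixP => i j; rewrite !mxE ffunE dotDr. Qed.

Lemma mxdot0l w : mxdot dot 0 w = 0.
Proof. by apply/matrixP => i j; rewrite !mxE ffunE linear0l. Qed.

Lemma mxdot0r v : mxdot dot v 0 = 0.
Proof. by apply/matrixP => i j; rewrite !mxE ffunE linear0r. Qed.

Lemma mxdot_opact (T : 'End(V)) v w : (forall x y, dot (T x) y = dot x (T y)) ->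
  mxdot dot (opact (T \o T)%VF v) w = mxdot dot v (opact (T \o T)%VF w).
Proof.
by move=> sT; apply/matrixP => i j; rewrite !mxE !ffunE !comp_lfunE/= !sT.
Qed.

Lemma big_ord_double (M : nmodType) n (F : nat -> M) :
  \sum_(j < n.*2) F j = \sum_(j < n) (F j.*2 + F j.*2.+1).
Proof.
elim: n => [|n IH]; first by rewrite !big_ord0.
by rewrite doubleS !big_ord_recr/= IH addrA.
Qed.

(** Each entry is a scalar Parseval sum whose terms are grouped in consecutive pairs; the matrix
    product sums over one pair. *)
Lemma mxdot_parseval {n m} (s : n.-tuple V) v w : n = m.*2 -> orthonormal_basis dot s ->
  \sum_(j < m) mxdot dot v (block s j) *m adjmx (mxdot dot w (block s j))
  = mxdot dot v w.
Proof.
move=> nm os; subst n; apply/matrixP => i j; rewrite summxE [RHS]mxE (parseval _ _ os).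
rewrite (big_ord_double _ (fun l => dot (v i) s`_l * Num.conj (dot (w j) s`_l))).
by apply: eq_bigr => l _; rewrite !mxE !big_ord_recl big_ord0 !mxE !ffunE/= addr0.
Qed.

Lemma block_nth (s : seq V) k (i : 'I_2) : block s k i = s`_(k.*2 + i).
Proof.
by rewrite ffunE; have [j ->|->] := unliftP ord0 i; rewrite ?[j]ord1 ?addn1 ?addn0.
Qed.

Lemma mxdot_block {n m} (s : n.-tuple V) k l : n = m.*2 -> orthonormal_basis dot s ->
  (k < m)%N -> (l < m)%N -> mxdot dot (block s k) (block s l) = (k == l)%:R%:M.
Proof.
move=> nm os km lm; apply/matrixP => i j; rewrite !mxE !block_nth.
have i2 := ltn_ord i; have j2 := ltn_ord j.
rewrite onb_dotE//; [|lia|lia].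
have -> : (k.*2 + i == l.*2 + j)%N = (k == l) && (i == j).
  by rewrite -(inj_eq val_inj)/=; lia.
by case: (k == l); case: (i == j).
Qed.

End InnerProduct.

(** * Squares of diagonal and tridiagonal operators, read on pairs of basis vectors *)

Section ThreeTermSquare.
Context {R : realType} {V : vectType R[i]}.

(** Turns identities between vectors into scalar ones, on which [ring] works. *)
Lemma coord_inj (u v : V) :
  (forall i, coord (vbasis fullv) i u = coord (vbasis fullv) i v) -> u = v.
Proof.
move=> uv; rewrite (coord_vbasis (memvf u)) (coord_vbasis (memvf v)).
by apply: eq_bigr => i _; rewrite uv.
Qed.

(** The formula is uniform in [k]: beyond the end of [s] the default value of [nth] is 0, and where
    a truncated predecessor names a wrong vector its coefficient contains the factor [r 0 = 0]. *)
Lemma three_term_sqr {d} (s : d.+1.-tuple V) (T : 'End(V))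
    (r : nat -> R) (b : R) :
  r 0%N = 0 -> r d.+1 = 0 ->
  (forall k, (k <= d)%N -> T s`_k = (r k.+1)%:C *: s`_k.+1 + (r k)%:C *: s`_k.-1
     + b%:C *: s`_k) ->
  forall k, (k <= d)%N -> T (T s`_k) =
    (r k.+1 * r k.+2)%:C *: s`_k.+2 + (2 * b * r k.+1)%:C *: s`_k.+1
    + (r k ^+ 2 + r k.+1 ^+ 2 + b ^+ 2)%:C *: s`_k
    + (2 * b * r k)%:C *: s`_k.-1 + (r k * r k.-1)%:C *: s`_k.-2.
Proof.
move=> r0 rd Ts k kd.
(* The expansion of [T] at index [k.+1] is available only up to [d]; the factor [r k.+1] makes the
   identity hold for [k = d] too, as [r d.+1 = 0]. *)
have TsS : (r k.+1)%:C *: T s`_k.+1 = (r k.+1)%:C *: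
    ((r k.+2)%:C *: s`_k.+2 + (r k.+1)%:C *: s`_k + b%:C *: s`_k.+1).
  move: kd; rewrite leq_eqVlt => /predU1P[->|kd]; last by rewrite Ts.
  by rewrite rd !scale0r.
have TsP : (r k)%:C *: T s`_k.-1 = (r k)%:C *:
    ((r k)%:C *: s`_k + (r k.-1)%:C *: s`_k.-2 + b%:C *: s`_k.-1).
  by case: k kd {TsS} => [|k] kd; rewrite ?r0 ?scale0r// Ts// ltnW.
rewrite [T s`_k]Ts// !linearD !linearZ/= TsS TsP Ts//.
apply: coord_inj => i; rewrite !(linearD, linearZ).
by rewrite !(rmorphD, rmorphM, rmorphXn, rmorph1)/=; ring.
Qed.

Lemma block_diag_sqr {n m} (s : n.-tuple V) (T : 'End(V)) (a : nat -> R) :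
  n = m.*2 -> (forall k, (k < n)%N -> T s`_k = (a k)%:C *: s`_k) ->
  forall k, (k < m)%N ->
    opact (T \o T)%VF (block s k)
    = mxact (mx22 (a k.*2 ^+ 2) 0 0 (a k.*2.+1 ^+ 2)) (block s k).
Proof.
move=> nm Ts k km; apply: ffun2P;
  rewrite !ffunE comp_lfunE/= !Ts ?linearZ/= ?Ts; try lia;
  rewrite !big_ord_recl big_ord0 !ffunE !mxE/= !scale0r ?addr0 ?add0r;
  by rewrite scalerA real_complexM expr2.
Qed.

(** The square of [T] couples indices at distance at most 2, so from the pair $2k,2k+1$ it reaches
    only the two adjacent pairs. *)
Lemma block_three_term_sqr {d m} (s : d.+1.-tuple V) (T : 'End(V))
    (r : nat -> R) (b : R) :
  d.+1 = m.+1.*2 -> r 0%N = 0 -> r d.+1 = 0 ->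
  (forall k, (k <= d)%N -> T s`_k = (r k.+1)%:C *: s`_k.+1 + (r k)%:C *: s`_k.-1
     + b%:C *: s`_k) ->
  let A k := mx22 (r k.*2 * r k.*2.-1) (2 * b * r k.*2) 0 (r k.*2 * r k.*2.+1) in
  let B k := mx22 (r k.*2 ^+ 2 + r k.*2.+1 ^+ 2 + b ^+ 2) (2 * b * r k.*2.+1)
    (2 * b * r k.*2.+1) (r k.*2.+1 ^+ 2 + r k.*2.+2 ^+ 2 + b ^+ 2) in
  forall k, (k <= m)%N ->
    opact (T \o T)%VF (block s k)
    = (if (k < m)%N then mxact (adjmx (A k.+1)) (block s k.+1) else 0)
      + mxact (B k) (block s k)
      + (if (0 < k)%N then mxact (A k) (block s k.-1) else 0).
Proof.
move=> dm r0 rd Ts A B k km.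
have up (i : 'I_2) :
    (if (k < m)%N then mxact (adjmx (A k.+1)) (block s k.+1) else 0) i
    = mxact (adjmx (A k.+1)) (block s k.+1) i.
  case: ltnP => // mk; have -> : k = m by lia.
  rewrite ffunE /A adjmx_mx22 -dm rd.
  by rewrite !mul0r mulr0 ffunE big1// => j _; rewrite mxE !if_same scale0r.
have down (i : 'I_2) : (if (0 < k)%N then mxact (A k) (block s k.-1) else 0) i
    = mxact (A k) (block s k.-1) i.
  case: k {km up} => //=.
  rewrite ffunE /A double0 r0.
  by rewrite !mul0r mulr0 ffunE big1// => j _; rewrite mxE !if_same scale0r.
apply: ffun2P; rewrite !(ffunE, up, down) comp_lfunE/= (three_term_sqr r0 rd Ts); try lia;
  rewrite !big_ord_recl !big_ord0 !ffunE !addr0 !adjmx_mx22 !mxE/=.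
- case: k {km up down} => [|k]; apply: coord_inj => i; rewrite !(linearD, linearZ)/=.
  + by rewrite r0 !(mul0r, mulr0) ?rmorph0; ring.
  + by rewrite ?doubleS/= ?rmorph0; ring.
- case: k {km up down} => [|k]; apply: coord_inj => i; rewrite !(linearD, linearZ)/=.
  + by rewrite r0 !(mul0r, mulr0) ?rmorph0; ring.
  + by rewrite ?doubleS/= ?rmorph0; ring.
Qed.

End ThreeTermSquare.

(** * Polynomials over a noncommutative ring defined by a three-term recurrence *)

Section MatrixPolynomials.
Context {A : unitRingType} (a b c : nat -> A).

(** The recurrence $p_kX=c_{k+1}p_{k+1}+b_kp_k+a_kp_{k-1}$ solved for $p_{k+1}$. Coefficients
    multiply from the left and $X$ from the right, so evaluation respects each operation even at
    points that do not commute with the coefficients. *)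
Fixpoint three_term_poly k : {poly A} :=
  match k with
  | 0 => 1
  | k1.+1 =>
      (c k)^-1%:P * (three_term_poly k1 * 'X - (b k1)%:P * three_term_poly k1
        - match k1 with 0 => 0 | k2.+1 => (a k1)%:P * three_term_poly k2 end)
  end.

Lemma size_coefM (x : A) (p : {poly A}) : (size (x%:P * p)%R <= size p)%N.
Proof. by rewrite mul_polyC size_scale_leq. Qed.

Lemma three_term_polyS k : three_term_poly k.+1 =
  (c k.+1)^-1%:P * (three_term_poly k * 'X - (b k)%:P * three_term_poly k
        - if (0 < k)%N then (a k)%:P * three_term_poly k.-1 else 0).
Proof. by case: k. Qed.

Lemma size_three_term_poly k : (size (three_term_poly k) <= k.+1)%N.
Proof.
elim/ltn_ind: k => -[_|k IH]; first by rewrite size_poly1.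
rewrite three_term_polyS (leq_trans (size_coefM _ _))//.
have ik := IH k (ltnSn k).
rewrite (leq_trans (size_polyD _ _))// geq_max size_polyN; apply/andP; split.
  rewrite (leq_trans (size_polyD _ _))// geq_max size_polyN; apply/andP; split.
    by rewrite (leq_trans (size_polyMleq _ _))// size_polyX addn2.
  by rewrite (leq_trans (size_coefM _ _))// ltnW.
case: ltnP => k0; last by rewrite size_poly0.
rewrite (leq_trans (size_coefM _ _))//.
have ik1 : (k.-1 < k.+1)%N by lia.
by rewrite (leq_trans (IH _ ik1))//; lia.
Qed.

(** Only the term with ['X] reaches degree [k.+1], so the leading coefficient is $c_k^{-1}\cdots
    c_1^{-1}$. *)
Lemma lead_three_term_poly m : (forall k, (1 <= k <= m)%N -> c k \is a GRing.unit) ->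
  forall k, (k <= m)%N -> (three_term_poly k)`_k \is a GRing.unit.
Proof.
move=> cu; elim=> [_|k IH km]; first by rewrite coefC unitr1.
rewrite three_term_polyS coefCM !coefB coefMX/= coefCM.
rewrite [(three_term_poly k)`_k.+1]nth_default ?size_three_term_poly// mulr0 subr0.
have -> : (if (0 < k)%N then (a k)%:P * three_term_poly k.-1 else 0)`_k.+1 = 0.
  case: ltnP => k0; last by rewrite coef0.
  rewrite nth_default// (leq_trans (size_coefM _ _))//.
  by rewrite (leq_trans (size_three_term_poly _))//; lia.
by rewrite subr0 unitrMl ?unitrV ?cu// IH// ltnW.
Qed.

(** The recurrence and the initial value determine [g]. As the polynomials do not involve [t], one
    family serves all points at which such a [g] exists. *)
Lemma horner_three_term_poly m (t : A) (g : nat -> A) :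
  (forall k, (1 <= k <= m)%N -> c k \is a GRing.unit) -> g 0%N = 1 ->
  (forall k, (k < m)%N -> g k * t =
     c k.+1 * g k.+1 + b k * g k + if (0 < k)%N then a k * g k.-1 else 0) ->
  forall k, (k <= m)%N -> (three_term_poly k).[t] = g k.
Proof.
move=> cu g0 gS; elim/ltn_ind => -[_ _|k IH km]; first by rewrite hornerC.
rewrite three_term_polyS hornerCM hornerD hornerN hornerD hornerN hornerMX.
rewrite hornerCM (IH k)//; last exact: ltnW.
apply: (canLR (mulKr _)); first by rewrite cu.
rewrite gS//; case: ltnP => k0; last by rewrite horner0 !addr0 subr0 addrK.
rewrite hornerCM IH//; [|lia|lia].
by rewrite addrAC !addrK.
Qed.

End MatrixPolynomials.

(* Equal to [sqrt (h_k / h_0)]: the ratio between the monic polynomial [P_k]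
   and the orthonormal one. *)
Definition monic_scale {R : realType} (N d beta k : nat) : R :=
  \prod_(1 <= i < k.+1) (2 * sin (omega N) * rho N d beta i).

(** * Overlaps of the two eigenbases as $q$-ultraspherical polynomials *)

Section Overlaps.
Context {R : realType} {N d beta : nat} (b : R).
Context {V : vectType R[i]} (dot : {dot V for Num.conj}).
Context (ket phi : d.+1.-tuple V) (P H : 'End(V)).
Hypothesis d_gt0 : (0 < d)%N.
Hypothesis beta_gt0 : (0 < beta)%N.
Hypothesis Nd : (N = d + beta.*2)%N.
Hypothesis onb_ket : orthonormal_basis dot ket.
Hypothesis onb_phi : orthonormal_basis dot phi.
Hypothesis P_ket : forall k, (k <= d)%N -> P ket`_k =
  (rho N d beta k.+1)%:C *: ket`_k.+1 + (rho N d beta k)%:C *: ket`_k.-1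
  + b%:C *: ket`_k.
Hypothesis P_phi : forall j, (j <= d)%N -> P phi`_j = (mu N beta b j)%:C *: phi`_j.
Hypothesis H_ket : forall k, (k <= d)%N -> H ket`_k = (lam N beta k)%:C *: ket`_k.
Hypothesis H_phi : forall j, (j <= d)%N -> H phi`_j =
  (rho N d beta j.+1)%:C *: phi`_j.+1 + (rho N d beta j)%:C *: phi`_j.-1.
Hypothesis phase : 0 < dot ket`_0 phi`_0.

Local Notation rho k := (rho N d beta k : R).
Local Notation w j := (wt N beta j : R).
Local Notation h k := (hnorm N d beta k : R).
Local Notation p k j := ((Pq N d beta k).[xpt N beta j] : R).
Local Notation om := (omega N : R).
Local Notation kappa k := (monic_scale N d beta k : R).

Lemma P_selfadjoint u v : dot (P u) v = dot u (P v).
Proof. exact: (real_diag_selfadjoint onb_phi (a := mu N beta b)). Qed.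

Lemma H_selfadjoint u v : dot (H u) v = dot u (H v).
Proof. exact: (real_diag_selfadjoint onb_ket (a := lam N beta)). Qed.

(** Self-adjointness of [P]; the shift [b] occurs on both sides and cancels, which leaves
    $\lambda_j$ instead of $\mu_j$. *)
Lemma overlap_recr_ket k j : (k <= d)%N -> (j <= d)%N ->
  (rho k.+1)%:C * dot ket`_k.+1 phi`_j + (rho k)%:C * dot ket`_k.-1 phi`_j
  = (lam N beta j)%:C * dot ket`_k phi`_j.
Proof.
move=> kd jd; have := P_selfadjoint ket`_k phi`_j.
rewrite P_ket// P_phi// !dotDl !dotZl dotZr conj_real_complex /mu rmorphD mulrDl.
by move=> /addIr.
Qed.

Lemma overlap_recr_phi k j : (k <= d)%N -> (j <= d)%N ->
  (rho j.+1)%:C * dot ket`_k phi`_j.+1 + (rho j)%:C * dot ket`_k phi`_j.-1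
  = (lam N beta k)%:C * dot ket`_k phi`_j.
Proof.
move=> kd jd; have := H_selfadjoint ket`_k phi`_j.
by rewrite H_ket// H_phi// dotZl !dotDr !dotZr !conj_real_complex => ->.
Qed.

Lemma w_gt0 j : (j <= d)%N -> 0 < w j.
Proof. exact: wt_gt0. Qed.

Lemma sum_w : \sum_(j < d.+1) w j = h 0.
Proof.
by apply: eq_bigr => j _; rewrite hornerC expr1n mul1r.
Qed.

Lemma h0_gt0 : 0 < h 0.
Proof.
rewrite -sum_w big_ord_recl ltr_pwDl ?w_gt0// sumr_ge0// => j _.
by rewrite ltW// w_gt0// -ltnS.
Qed.

(** Since $\rho_{j+1}\neq0$, the recurrence of [overlap_recr_phi] at [k = 0] has a one-dimensional
    solution space, and [sqrt_wt_recr] supplies a solution. *)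
Lemma overlap0_propto j : (j <= d)%N ->
  dot ket`_0 phi`_j =
    (complex.Re (dot ket`_0 phi`_0) / Num.sqrt (w 0) * Num.sqrt (w j))%:C.
Proof.
set t := _ / _.
elim/ltn_ind: j => -[_ _|j IH jd].
  (* Positivity of a complex number includes that it is real, so [phase] allows taking the real
     part. *)
  rewrite /t mulfVK ?gt_eqF ?sqrtr_gt0 ?w_gt0// RRe_real//.
  exact/gtr0_real.
have rC : (rho j.+1)%:C != 0 :> R[i].
  by rewrite fmorph_eq0 gt_eqF ?(rho_gt0 beta_gt0 Nd).
apply: (mulfI rC).
have /(canRL (addrK _)) -> := overlap_recr_phi (leq0n d) (ltnW jd).
have jp : (rho j)%:C * dot ket`_0 phi`_j.-1 = (rho j * (t * Num.sqrt (w j.-1)))%:C.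
  case: j IH jd {rC} => [|j] IH jd; first by rewrite rho_out// !mul0r.
  by rewrite [RHS]rmorphM/= -IH//; lia.
rewrite jp (IH j (ltnSn j) (ltnW jd)).
rewrite !real_complexM real_complexB; congr real_complex_def.
have /(canRL (addrK _)) e := sqrt_wt_recr (R := R) beta_gt0 Nd jd.
by rewrite [RHS]mulrCA e; ring.
Qed.

(** Parseval for the unit vector $|0\rangle$ gives $t^2h_0=1$ for the constant of proportionality,
    and [phase] selects the positive root. *)
Lemma overlap0E j : (j <= d)%N -> dot ket`_0 phi`_j = (Num.sqrt (w j) / Num.sqrt (h 0))%:C.
Proof.
have := overlap0_propto; set t := _ / _ => ct jd.
have t0 : 0 < t.
  by move: phase; rewrite ltcE /= => /andP[_ c0]; rewrite divr_gt0 ?sqrtr_gt0 ?w_gt0.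
have n1 : dot ket`_0 ket`_0 = 1 by rewrite onb_dotE.
have /complexI : (t ^+ 2 * h 0)%:C = 1%:C.
  rewrite [RHS]rmorph1 -[RHS]n1 [RHS](parseval _ _ onb_phi).
  rewrite -sum_w mulr_sumr rmorph_sum; apply: eq_bigr => i _.
  rewrite ct -1?ltnS// conj_real_complex real_complexM; congr real_complex_def.
  rewrite -[w i in LHS]sqr_sqrtr ?ltW ?w_gt0 -1?ltnS//; ring.
move=> th; rewrite ct// mulrC; congr (_ * _)%:C.
have h00 := h0_gt0.
apply/eqP; rewrite -(@eqrXn2 _ 2) ?invr_ge0 ?sqrtr_ge0 ?(ltW t0)//.
rewrite exprVn sqr_sqrtr ?(ltW h00)//; apply/eqP/(mulIf (lt0r_neq0 h00)).
by rewrite th mulVf ?lt0r_neq0.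
Qed.

Lemma kappa_gt0 k : (k <= d)%N -> 0 < kappa k.
Proof.
move=> kd; rewrite /monic_scale big_nat_cond prodr_gt0// => i /andP[/andP[i1 ik] _].
rewrite !mulr_gt0 ?(sin_omega1_gt0 beta_gt0 Nd)//.
by rewrite (rho_gt0 beta_gt0 Nd)//; lia.
Qed.

Lemma kappaS k : kappa k.+1 = kappa k * (2 * sin om * rho k.+1).
Proof. by rewrite /monic_scale big_nat_recr. Qed.

Lemma PqSS k x : (Pq N d beta k.+2).[x]
  = x * (Pq N d beta k.+1).[x]
    - 4 * sin om ^+ 2 * rho k.+1 ^+ 2 * (Pq N d beta k).[x].
Proof. by rewrite /= hornerD hornerN hornerZ hornerM hornerX. Qed.

(** Scaling by [kappa k] turns the symmetric recurrence in [k] into the monic one, with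
    $x_j=2\sin(\omega)\lambda_j$. *)
Lemma kappa_overlap k j : (k <= d)%N -> (j <= d)%N ->
  (kappa k)%:C * dot ket`_k phi`_j = (p k j * (Num.sqrt (w j) / Num.sqrt (h 0)))%:C.
Proof.
move=> + jd; elim/ltn_ind: k => -[_ _|[_ _|k IH kd]].
- by rewrite overlap0E// /monic_scale big_geq// hornerC !mul1r.
- have := @overlap_recr_ket 0 j (leq0n d) jd.
  rewrite [rho 0]rho_out// rmorph0 mul0r addr0 kappaS /monic_scale big_geq// mul1r hornerX => e.
  rewrite -(real_complexM (2 * sin om)) -mulrA e overlap0E// !real_complexM.
  congr real_complex_def.
  by rewrite (xpt_lam beta_gt0 Nd)//; ring.
- have := @overlap_recr_ket k.+1 j (ltnW kd) jd.
  move=> /(canRL (addrK _)) e.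
  rewrite kappaS -real_complexM -(real_complexM (2 * sin om)) -!mulrA e.
  (* In the last term [kappa k.+1] is unfolded once more; its factor $2\sin(\omega)\rho_{k+1}$
     completes the coefficient $4\sin^2(\omega)\rho_{k+1}^2$. *)
  have -> : (kappa k.+1)%:C * ((2 * sin om)%:C *
      ((lam N beta j)%:C * dot ket`_k.+1 phi`_j
       - (rho k.+1)%:C * dot ket`_k.+1.-1 phi`_j))
    = (2 * sin om * lam N beta j)%:C * ((kappa k.+1)%:C * dot ket`_k.+1 phi`_j)
      - (2 * sin om * (2 * sin om * rho k.+1 * rho k.+1))%:C
        * ((kappa k)%:C * dot ket`_k phi`_j).
    by rewrite kappaS !rmorphM /=; ring.
  rewrite !IH//; [|lia|lia]; rewrite !real_complexM real_complexB; congr real_complex_def.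
  by rewrite PqSS (xpt_lam beta_gt0 Nd)//; ring.
Qed.

(** Parseval for the unit vector $|k\rangle$, scaled by [kappa k]. *)
Lemma hnorm_kappa k : (k <= d)%N -> h k = kappa k ^+ 2 * h 0.
Proof.
move=> kd; have h00 := h0_gt0.
suff /complexI e : (kappa k ^+ 2)%:C = (h k / h 0)%:C by rewrite e mulfVK ?gt_eqF.
have -> : (kappa k ^+ 2)%:C = (kappa k ^+ 2)%:C * dot ket`_k ket`_k.
  by rewrite onb_dotE// eqxx mulr1.
rewrite (parseval _ _ onb_phi) mulr_sumr [h k]/hnorm mulr_suml rmorph_sum.
apply: eq_bigr => j _; have jd : (j <= d)%N by rewrite -ltnS.
have -> : (kappa k ^+ 2)%:C * (dot ket`_k phi`_j * Num.conj (dot ket`_k phi`_j))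
  = ((kappa k)%:C * dot ket`_k phi`_j) * Num.conj ((kappa k)%:C * dot ket`_k phi`_j).
  by rewrite rmorphM [in RHS]rmorphM/= conj_real_complex; ring.
rewrite kappa_overlap// conj_real_complex real_complexM; congr real_complex_def.
rewrite -[h 0 in RHS]sqr_sqrtr ?(ltW h00)// -[w j in RHS]sqr_sqrtr ?(ltW (w_gt0 jd))//.
by field; rewrite gt_eqF ?sqrtr_gt0.
Qed.

Lemma hnorm_gt0 k : (k <= d)%N -> 0 < h k.
Proof. by move=> kd; rewrite hnorm_kappa// mulr_gt0 ?exprn_gt0 ?kappa_gt0 ?h0_gt0. Qed.

Lemma overlapE k j : (k <= d)%N -> (j <= d)%N ->
  dot ket`_k phi`_j = ((Num.sqrt (h k))^-1 * p k j * Num.sqrt (w j))%:C.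
Proof.
move=> kd jd; have k0 := kappa_gt0 kd; have h00 := h0_gt0.
have kC : (kappa k)%:C != 0 :> R[i] by rewrite fmorph_eq0 gt_eqF.
apply: (mulfI kC); rewrite kappa_overlap// real_complexM; congr real_complex_def.
rewrite [h k]hnorm_kappa// [Num.sqrt (kappa k ^+ 2 * _)]sqrtrM ?sqr_ge0//.
rewrite sqrtr_sqr gtr0_norm//.
by field; rewrite !gt_eqF ?sqrtr_gt0.
Qed.

End Overlaps.

(** * The matrix valued polynomials and their bispectral properties *)

Unset Implicit Arguments.
Set Strict Implicit.

(** The action of [H] fixes the relative phases of the $\phi_j$, and [hphase] fixes the common one,
    matching the positive roots $w_j^{1/2}$. The expansion of $H^2$ uses the coefficients at
    [b = 0], and the difference equation has [invmx (E j)] on the right because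
    $\Pi_k(\theta_j)=(e_k,\Phi_j)(e_0,\Phi_j)^{-1}$. *)
Theorem mainTheorem4 (R : realType) (N m d beta : nat) (b : R)
  (hN : (0 < N)%N) (hm : d.+1 = (2 * m.+1)%N) (hd : (1 <= d <= N - 1)%N)
  (hbeta : (2 * beta)%N = (N - d)%N)
  (V : vectType R[i]) (dot : {dot V for Num.conj})
  (ket : (d.+1).-tuple V) (hket : orthonormal_basis dot ket)
  (K0 K1 : 'End(V))
  (hK0 : forall k : nat, (k <= d)%N -> K0 ket`_k = (lam N beta k)%:C *: ket`_k)
  (hK1 : forall k : nat, (k <= d)%N ->
     K1 ket`_k = (rho N d beta k.+1)%:C *: ket`_k.+1
                 + (rho N d beta k)%:C *: ket`_k.-1)
  (P H : 'End(V)) (hP : P = K1 + b%:C *: \1%VF) (hH : H = K0)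
  (phi : (d.+1).-tuple V) (hphi : orthonormal_basis dot phi)
  (hPphi : forall j : nat, (j <= d)%N -> P phi`_j = (mu N beta b j)%:C *: phi`_j)
  (hHphi : forall j : nat, (j <= d)%N ->
     H phi`_j = (rho N d beta j.+1)%:C *: phi`_j.+1
                + (rho N d beta j)%:C *: phi`_j.-1)
  (hphase : 0 < dot ket`_0 phi`_0) :
  let e := block ket in
  let Phi := block phi in
  let E j := mxdot dot (e 0%N) (Phi j) in
  let alpha := alphamx N beta b in
  let Lambda := Lambdamx N beta in
  let A := Amx N d beta b in
  let B := Bmx N d beta b in
  let A0 := Amx N d beta (0 : R) in
  let B0 := Bmx N d beta (0 : R) in
  let L := Lmx N d beta in
  let W := Wmx N d beta in
  let theta := thetamx dot ket phi N beta b in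
  [/\ forall j : nat, (j <= m)%N ->
        opact (P \o P)%VF (Phi j) = mxact (alpha j) (Phi j),
      forall k : nat, (k <= m)%N ->
        opact (H \o H)%VF (e k) = mxact (Lambda k) (e k),
      forall k : nat, (k <= m)%N ->
        opact (P \o P)%VF (e k) =
          (if (k < m)%N then mxact (adjmx (A k.+1)) (e k.+1) else 0)
          + mxact (B k) (e k)
          + (if (0 < k)%N then mxact (A k) (e k.-1) else 0)
    & forall j : nat, (j <= m)%N ->
        opact (H \o H)%VF (Phi j) =
          (if (j < m)%N then mxact (adjmx (A0 j.+1)) (Phi j.+1) else 0)
          + mxact (B0 j) (Phi j)
          + (if (0 < j)%N then mxact (A0 j) (Phi j.-1) else 0)]
  /\ [/\ forall k : nat, (1 <= k <= m)%N -> A k \in unitmx,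
         forall k : nat, (k <= m)%N -> B k = adjmx (B k),
         forall j : nat, (j <= m)%N -> L j \in unitmx,
         forall j : nat, (j <= m)%N -> E j = L j *m sqrtDmx N beta j
       & forall j : nat, (j <= m)%N -> E j \in unitmx]
  /\ exists Pi : nat -> {poly 'M[R[i]]_2},
     (forall k : nat, (k <= m)%N ->
        (size (Pi k) <= k.+1)%N /\ (Pi k)`_k \in unitmx)
     /\ forall j k l : nat, (j <= m)%N -> (k <= m)%N -> (l <= m)%N ->
     [/\ (Pi 0%N).[theta j] = 1%:M /\
         (Pi k).[theta j] *m theta j =
           (if (k < m)%N then adjmx (A k.+1) *m (Pi k.+1).[theta j] else 0)
           + B k *m (Pi k).[theta j]
           + (if (0 < k)%N then A k *m (Pi k.-1).[theta j] else 0),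
         \sum_(i < m.+1)
            (Pi k).[theta i] *m W i *m adjmx (Pi l).[theta i]
         = (k == l)%:R%:M,
         Lambda k *m (Pi k).[theta j] =
           (if (j < m)%N then
              (Pi k).[theta j.+1] *m E j.+1 *m A0 j.+1 *m invmx (E j) else 0)
           + (Pi k).[theta j] *m E j *m B0 j *m invmx (E j)
           + (if (0 < j)%N then
                (Pi k).[theta j.-1] *m E j.-1 *m adjmx (A0 j) *m invmx (E j)
              else 0)
       & (Pi k).[theta j] = Rmx N d beta k j *m invmx (L j)].
Proof.
have d_gt0 : (0 < d)%N by lia.
have beta_gt0 : (0 < beta)%N by lia.
have Nd : (N = d + beta.*2)%N by lia.
have dm : d.+1 = m.+1.*2 by lia.
have P_ket k : (k <= d)%N -> P ket`_k = (rho N d beta k.+1)%:C *: ket`_k.+1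
    + (rho N d beta k)%:C *: ket`_k.-1 + b%:C *: ket`_k.
  by move=> kd; rewrite hP add_lfunE scale_lfunE id_lfunE hK1.
have H_ket k : (k <= d)%N -> H ket`_k = (lam N beta k)%:C *: ket`_k.
  by rewrite hH; apply: hK0.
(* The zero diagonal term brings [H] into the shape of [P_ket], so one block lemma covers both
   operators. *)
have H_phi j : (j <= d)%N -> H phi`_j = (rho N d beta j.+1)%:C *: phi`_j.+1
    + (rho N d beta j)%:C *: phi`_j.-1 + (0 : R)%:C *: phi`_j.
  by move=> jd; rewrite scale0r addr0 hHphi.
have P_sa := P_selfadjoint hphi hPphi.
have H_sa := H_selfadjoint hket H_ket.
have ov k j := overlapE d_gt0 beta_gt0 Nd hket hphi P_ket hPphi H_ket hHphi
  hphase (k := k) (j := j).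
have h_gt0 k := hnorm_gt0 d_gt0 beta_gt0 Nd hket hphi P_ket hPphi H_ket hHphi
  hphase (k := k).
move=> e Phi E alpha Lambda A B A0 B0 L W theta.
have rho0 : rho N d beta 0 = 0 :> R by rewrite rho_out.
have rhod : rho N d beta d.+1 = 0 :> R by rewrite rho_out// ltnn andbF.
have alphaE := block_diag_sqr dm hPphi.
have LambdaE := block_diag_sqr dm H_ket.
have P2e := block_three_term_sqr dm rho0 rhod P_ket.
have H2Phi := block_three_term_sqr dm rho0 rhod H_phi.
have BE k : B k = adjmx (B k) by rewrite /B /Bmx adjmx_mx22.
have B0E k : B0 k = adjmx (B0 k) by rewrite /B0 /Bmx adjmx_mx22.
have A_unit k : (1 <= k <= m)%N -> A k \in unitmx.
  move=> km; apply: unitmx22; rewrite mulr0 subr0.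
  by rewrite !mulf_neq0// gt_eqF// (rho_gt0 beta_gt0 Nd)//; lia.
have L_unit j : (j <= m)%N -> L j \in unitmx.
  move=> jm; rewrite unitmx_mul !unitmx22//.
    (* As $P_1=X$, the determinant of the second factor is $x_{2j+1}-x_{2j}$. *)
    rewrite /= !hornerX !mul1r subr_eq0; apply/eqP => /(xpt_inj beta_gt0 Nd) xx.
    have : j.*2.+1 = j.*2 by apply: xx; lia.
    by lia.
  by rewrite mul0r subr0; apply: mulf_neq0; rewrite invr_eq0 gt_eqF// sqrtr_gt0 h_gt0.
have GE k j : (k <= m)%N -> (j <= m)%N ->
    mxdot dot (e k) (Phi j) = Rmx N d beta k j *m sqrtDmx N beta j.
  move=> km jm; rewrite mulmx22; apply/matrixP => i l; rewrite !mxE !ffunE.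
  have [i' ->|->] := unliftP ord0 i; have [l' ->|->] := unliftP ord0 l;
    by rewrite ov/=; [congr real_complex_def; ring|lia|lia].
have R0 j : Rmx N d beta 0 j = L j.
  rewrite /L /Lmx mulmx22; apply/matrixP => i l; rewrite !mxE.
  by case: (i == 0); case: (l == 0); congr real_complex_def; rewrite ?hornerC; ring.
have sD_unit j : (j <= m)%N -> sqrtDmx N beta j \in unitmx.
  move=> jm; apply: unitmx22.
  rewrite mulr0 subr0.
  by rewrite mulf_neq0// gt_eqF// sqrtr_gt0 (wt_gt0 beta_gt0 Nd)//; lia.
have EE j : (j <= m)%N -> E j = L j *m sqrtDmx N beta j.
  by move=> jm; rewrite /E GE// R0.
have E_unit j : (j <= m)%N -> E j \in unitmx.
  by move=> jm; rewrite EE// unitmx_mul L_unit// sD_unit.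
split; first by [].
split; first by split.
pose C k := adjmx (A k).
have C_unit k : (1 <= k <= m)%N -> C k \in unitmx.
  by rewrite adjmx_unit; apply: A_unit.
(* The value that $\Pi_k(\theta_j)$ has to take. *)
pose g k j := mxdot dot (e k) (Phi j) *m invmx (E j).
have gE k j : (j <= m)%N -> g k j *m E j = mxdot dot (e k) (Phi j).
  by move=> jm; rewrite mulmxKV// E_unit.
have g_recr k j : (k <= m)%N -> (j <= m)%N -> g k j *m theta j =
    (if (k < m)%N then C k.+1 *m g k.+1 j else 0) + B k *m g k j
    + (if (0 < k)%N then A k *m g k.-1 j else 0).
  (* The conjugation by [E j] in [theta j] cancels the inverse in [g], leaving
     $(e_k,\alpha_j\Phi_j)E_j^{-1}=(e_k,P^2\Phi_j)E_j^{-1}$; then $P^2$ is moved onto $e_k$. *)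
  move=> km jm; rewrite /theta /thetamx -/e -/Phi -/(E j) !mulmxA gE//.
  rewrite -mxdotZr -alphaE// -mxdot_opact// P2e// !mxdotDl !mulmxDl.
  rewrite mxdotZl -mulmxA; congr (_ + _ + _).
    by case: ifP => _; rewrite ?mxdot0l ?mul0mx// mxdotZl -mulmxA.
  by case: ifP => _; rewrite ?mxdot0l ?mul0mx// mxdotZl -mulmxA.
pose Pi := three_term_poly A B C.
have PiE k j : (k <= m)%N -> (j <= m)%N -> (Pi k).[theta j] = g k j.
  move=> km jm; apply: (horner_three_term_poly (m := m) (g := g^~ j)) => //.
    by rewrite /g -/(E j) mulmxV ?E_unit.
  by move=> l lm; have := g_recr l j (ltnW lm) jm; rewrite lm.
exists Pi; split.
  move=> k km; split; first exact: size_three_term_poly.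
  exact: lead_three_term_poly C_unit _ km.
move=> j k l jm km lm; split.
- split; first by rewrite /Pi /= hornerC.
  rewrite (PiE k)// g_recr//; congr (_ + _ + _).
    by case: ifP => // km1; rewrite PiE.
  by case: ifP => // k0; rewrite PiE//; lia.
(* With [W i] factored as [E i *m adjmx (E i)], the sum is block Parseval for $(e_k,e_l)$. *)
- rewrite -(mxdot_block dm hket km lm) -(mxdot_parseval _ _ dm hphi).
  apply: eq_bigr => i _; have im : (i <= m)%N by rewrite -ltnS.
  have EDE : sqrtDmx N beta i *m adjmx (sqrtDmx N beta i) = Dmx N beta i :> 'M[R[i]]_2.
    rewrite /sqrtDmx adjmx_mx22 mulmx22 !(mulr0, mul0r, addr0, add0r) -!expr2.
    by rewrite !sqr_sqrtr// ltW// (wt_gt0 beta_gt0 Nd)//; lia.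
  have -> : W i = E i *m adjmx (E i).
    by rewrite EE// adjmxM !mulmxA -(mulmxA (L i)) EDE.
  by rewrite !PiE// -(gE k i im) -(gE l i im) adjmxM !mulmxA.
- have gE' i : (i <= m)%N -> (Pi k).[theta i] *m E i = mxdot dot (e k) (Phi i).
    by move=> im; rewrite PiE// gE.
  (* The dual computation: $H^2$ is moved from $e_k$ onto $\Phi_j$. Its coefficients leave the
     second argument as adjoints on the right, which exchanges [A0] and [adjmx A0]. *)
  have -> : Lambda k *m (Pi k).[theta j] = mxdot dot (opact (H \o H)%VF (e k)) (Phi j)
      *m invmx (E j) by rewrite LambdaE// mxdotZl PiE// -mulmxA.
  rewrite mxdot_opact// H2Phi// !mxdotDr !mulmxDl (gE' j)//.
  congr (_ + _ + _).
  + case: ifP => jm1; last by rewrite mxdot0r mul0mx.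
    by rewrite gE'// mxdotZr adjmxK.
  + by rewrite mxdotZr -B0E.
  + case: ifP => j0; last by rewrite mxdot0r mul0mx.
    by rewrite gE' ?mxdotZr//; lia.
(* Both $(e_k,\Phi_j)$ and [E j] carry the right factor [sqrtDmx], which cancels in the quotient. *)
- rewrite PiE// /g GE// -[Rmx _ _ _ k j in LHS](mulmxKV (L_unit j jm)).
  by rewrite -(mulmxA _ (L j)) -EE// mulmxK ?E_unit.
Qed.
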